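(* Let $T$ be a rank one map, constructed by cutting and stacking with cutting parameter $(m_j)_{j\ge0}$ and spacers parameter $((a_i^{(j)})_{i=1}^{m_j})_{j\ge0}$. Suppose that for some real $\beta\le 1$ one has $m_j=\theta(j^\beta)$, i.e. there exist $c,C>0$ and $j_0$ such that $c\le \frac{m_j}{j^\beta}\le C$ for all $j\ge j_0$. Then $$\prod_{j=0}^{+\infty}M(P_j)=0.$$
   Context: $\mathbb{T}$ is the unit circle and $\lambda$ (also written $dz$) its normalized Lebesgue measure. A rank one map is determined by integers $m_k\in\{2,3,4,\dots\}$ ($k\ge 0$, cutting parameter) and non-negative integers $a_j^{(k)}$ ($1\le j\le m_k$, $k\ge 0$, spacers parameter): start with the unit interval viewed as a stack of height $h_0=1$; given the stack of height $h_k$, divide it into $m_k$ columns of equal width, put $a_j^{(k)}$ spacers above the $j$-th column, and stack the columns one on top of the other to get a stack of height $h_{k+1}=m_kh_k+\sum_{j=1}^{m_k}a_j^{(k)}$. In the limit this defines a measure preserving map $T$ on a finite or $\sigma$-finite measure space. The associated polynomials are $$P_k(z)=\frac1{\sqrt{m_k}}\sum_{j=0}^{m_k-1}z^{jh_k+s(k,j)},\qquad s(k,0)=0,\quad s(k,j)=\sum_{i=1}^{j}a_i^{(k)}.$$ The Mahler measure of $P_k$ is $M(P_k)=\exp\left(\int_{\mathbb{T}}\log|P_k(z)|\,dz\right)$; the infinite product denotes the limit of the partial products (which are non-increasing since $M(P_k)\le\|P_k\|_2=1$). *)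

(* Defs.v *)
From mathcomp Require Import all_boot all_order all_algebra.
From mathcomp Require Import complex.
From mathcomp Require Import all_classical all_reals all_analysis.

Set Implicit Arguments.
Unset Strict Implicit.
Unset Printing Implicit Defensive.

Import Order.TTheory GRing.Theory Num.Theory.
Import numFieldNormedType.Exports.

(* The data from which a rank one map is built by cutting and stacking.
   [spacer k j] is a_j^(k); only the values at 1 <= j <= cutting k are ever used. *)
Record rank_one_param := RankOneParam {
  cutting : nat -> nat;
  spacer : nat -> nat -> nat;
  cutting_ge2 : forall k, (2 <= cutting k)%N
}.

Fixpoint height (T : rank_one_param) (k : nat) : nat :=
  if k is k'.+1 then
    (cutting T k' * height T k' + \sum_(1 <= j < (cutting T k').+1) spacer T k' j)%N
  else 1%N.

(* s(k,j): the sum runs over 1 <= i <= j, so that s(k,0) = 0. *)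
Definition spacer_sum (T : rank_one_param) (k j : nat) : nat :=
  (\sum_(1 <= i < j.+1) spacer T k i)%N.

Local Open Scope ring_scope.
Local Open Scope complex_scope.
Local Open Scope classical_set_scope.

Definition rank_one_poly (R : realType) (T : rank_one_param) (k : nat) :
    {poly R[i]} :=
  ((Num.sqrt (cutting T k)%:R)^-1)%:C *:
    \sum_(0 <= j < cutting T k) 'X^(j * height T k + spacer_sum T k j).

Definition expi (R : realType) (x : R) : R[i] := cos x +i* sin x.

(* Integral over the unit circle for the normalized Lebesgue measure, i.e. the
   image of Lebesgue measure on [0, 1] under t |-> exp(2 pi i t). *)
Definition circle_integral (R : realType) (f : R[i] -> \bar R) : \bar R :=
  (\int[@lebesgue_measure R]_(t in `[0%R, 1%R]) f (expi (2 * pi * t)))%E.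

(* [lne] and [expeR] are the extended logarithm and exponential, with
   log 0 = -oo and exp(-oo) = 0. *)
Definition mahler_measure (R : realType) (p : {poly R[i]}) : \bar R :=
  expeR (circle_integral (fun z => lne (ComplexField.Normc.normc p.[z])%:E)).

(* Main.v *)
(* On the circle write |P|^2 = 1 + f, where P is one of the polynomials and m its
   number of terms. Then f has mean 0, and expanding f into cosines whose products
   all have nonnegative mean gives \int f^2 >= (m - 1)/(2m), whatever the spacers.
   Since |P|^2 <= m, the inequality log r <= (r^2 - 1)/2 - (r - 1)^2/2 yields
   log |P| <= f/2 - f^2/(4(m + 1)), whence M(P) <= exp(-1/(24m)). The growth
   hypothesis gives m_j = O(j), so that \sum_j 1/m_j diverges. *)
Require Import Defs.
From mathcomp Require Import all_boot all_order all_algebra.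
From mathcomp Require Import all_classical all_reals all_analysis.
From mathcomp Require Import complex ring lra.
Import Order.TTheory GRing.Theory Num.Theory.
Import numFieldNormedType.Exports.
Local Open Scope ring_scope.
Local Open Scope classical_set_scope.

(* Integrals of nonnegative functions are suprema over simple functions, so
   monotonicity needs no measurability; [lne] is not known to be measurable. *)
Lemma le_integral_nonmeasurable d (T : measurableType d) (R : realType)
    (mu : {measure set T -> \bar R}) (D : set T) (f g : T -> \bar R) :
  (forall x, D x -> (f x <= g x)%E) ->
  (\int[mu]_(x in D) f x <= \int[mu]_(x in D) g x)%E.
Proof.
have ge0_le (f1 f2 : T -> \bar R) : (forall x, D x -> (0 <= f1 x)%E) ->
    (forall x, D x -> (f1 x <= f2 x)%E) ->
    (\int[mu]_(x in D) f1 x <= \int[mu]_(x in D) f2 x)%E.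
  move=> f10 f12; rewrite !ge0_integralE//; last first.
    by move=> x Dx; rewrite (le_trans (f10 x Dx)) ?f12.
  apply: le_ereal_sup => _ [h hf <-]; exists h => //= x.
  by rewrite (le_trans (hf x))// lee_restrict.
move=> fg; rewrite integralE [leRHS]integralE leeB//; apply: ge0_le => // x Dx.
- by move: (x) (mem_set Dx); apply: funepos_le => y /set_mem; exact: fg.
- by move: (x) (mem_set Dx); apply: funeneg_le => y /set_mem; exact: fg.
Qed.

(** * Means of cosines over the circle *)

Section trigonometric_integrals.
Variable R : realType.
Local Notation mu := (@lebesgue_measure R).
Local Notation circle := (`[0%R, 1%R] : set R).

(** The real part of z^k at z = exp(2 pi i t); integer [k] allows for differences of exponents. *)
Definition cosfreq (k : int) (t : R) : R := cos (2 * pi * k%:~R * t).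

Lemma sin_intr_2pi (k : int) : sin (2 * pi * k%:~R) = 0 :> R.
Proof.
have sin_natr n : sin (2 * pi * n%:R) = 0 :> R.
  have := periodicn (@sinD2pi R) n 0.
  rewrite add0r sin0 => <-; congr sin.
  by rewrite -mulr_natr -[pi *+ 2]mulr_natr; ring.
case: k => n; first exact: sin_natr.
by rewrite NegzE rmorphN/= mulrN sinN sin_natr oppr0.
Qed.

Lemma continuous_cosfreq k : continuous (cosfreq k).
Proof.
move=> t; apply: (@continuous_comp _ _ _ ( *%R (2 * pi * k%:~R)) (@cos R)).
  exact: mulrl_continuous.
exact: continuous_cos.
Qed.

Lemma integrable_continuous_circle (f : R -> R) : continuous f ->
  mu.-integrable circle (EFin \o f).
Proof.
move=> cf; apply: continuous_compact_integrable; first exact: segment_compact.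
exact: continuous_subspaceT.
Qed.

Lemma Rintegral_cosfreq k : \int[mu]_(t in circle) cosfreq k t = (k == 0)%:R.
Proof.
have [->|k0] := eqVneq k 0.
  rewrite (@eq_Rintegral _ _ _ _ _ (cst 1)); last first.
    by move=> t _; rewrite /cosfreq mulr0 mul0r cos0.
  have circle1 : fine (lebesgue_measure circle) = 1.
    by rewrite lebesgue_measure_itv/= lte_fin ltr01 oppr0 adde0.
  by rewrite Rintegral_cst// mul1r; exact: circle1.
have w0 : 2 * pi * k%:~R != 0 :> R.
  by rewrite !mulf_neq0 ?intr_eq0// gt_eqF ?pi_gt0.
(* An antiderivative, vanishing at both 0 and 1 because [k] is an integer. *)
pose F (t : R) := (2 * pi * k%:~R)^-1 * sin (2 * pi * k%:~R * t).
have dF (t : R) : is_derive t 1 F (cosfreq k t).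
  have dw : is_derive t 1 (fun t : R => 2 * pi * k%:~R * t) (2 * pi * k%:~R).
    by apply: is_derive_eq (is_deriveZ _ _) _; rewrite /GRing.scale/= mulr1.
  apply: is_derive_eq (is_deriveZ _ (is_derive1_comp (is_derive_sin _) dw)) _.
  by rewrite /GRing.scale/= mulrCA mulVf// mulr1.
have cF : continuous F.
  by move=> t; apply/differentiable_continuous/derivable1_diffP; have [] := dF t.
rewrite /Rintegral (@continuous_FTC2 _ _ F)//.
- by rewrite /F mulr1 mulr0 sin0 sin_intr_2pi !mulr0 sube0.
- exact/continuous_subspaceT/continuous_cosfreq.
- split.
  + by move=> t _; have [] := dF t.
  + exact/cvg_at_right_filter/cF.
  + exact/cvg_at_left_filter/cF.
- by move=> t _; rewrite derive1E; have [] := dF t.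
Qed.

Lemma continuous_sum_cosfreq (I : Type) (s : seq I) (P : pred I) (k : I -> int) :
  continuous (fun t => \sum_(i <- s | P i) cosfreq (k i) t).
Proof.
elim: s => [|i s IHs].
  by under eq_fun do rewrite big_nil; move=> t; exact: cvg_cst.
under eq_fun do rewrite big_cons.
case: (P i) => // t.
by apply: cvgD; [exact: continuous_cosfreq|exact: IHs].
Qed.

Lemma Rintegral_sum_cosfreq (I : Type) (s : seq I) (P : pred I) (k : I -> int) :
  \int[mu]_(t in circle) (\sum_(i <- s | P i) cosfreq (k i) t) =
  \sum_(i <- s | P i) (k i == 0)%:R.
Proof.
elim: s => [|i s IHs].
  by under eq_Rintegral do rewrite big_nil; rewrite Rintegral_cst// mul0r big_nil.
under eq_Rintegral do rewrite big_cons.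
rewrite big_cons; case: (P i) => //.
rewrite RintegralD//.
- by rewrite IHs Rintegral_cosfreq.
- exact/integrable_continuous_circle/continuous_cosfreq.
- exact/integrable_continuous_circle/continuous_sum_cosfreq.
Qed.

Lemma cosfreqM k l t :
  cosfreq k t * cosfreq l t = 2^-1 * (cosfreq (k + l) t + cosfreq (k - l) t).
Proof.
rewrite /cosfreq rmorphD rmorphB/=; move: (2 * pi) => w.
by rewrite !(mulrDr, mulrDl) mulrN mulNr cosD cosB; field.
Qed.

(** Expanding the square turns each product into half a sum of two cosines, each of mean 0 or 1. A
    diagonal pair has difference frequency 0 and contributes at least 1/2; coincidences among
    frequencies only increase the integral. *)
Lemma Rintegral_sqr_sum_cosfreq_ge (I : finType) (P : pred I) (k : I -> int) :
  2^-1 * #|P|%:R <=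
  \int[mu]_(t in circle) (\sum_(i | P i) cosfreq (k i) t) ^+ 2.
Proof.
under eq_Rintegral => t _.
  rewrite expr2 big_distrlr/= pair_big/=.
  under eq_bigr do rewrite cosfreqM.
  rewrite -mulr_sumr big_split/=.
  over.
have int_sum (f : I * I -> int) : mu.-integrable circle
    (EFin \o (fun t => \sum_(p : I * I | P p.1 && P p.2) cosfreq (f p) t)).
  exact/integrable_continuous_circle/continuous_sum_cosfreq.
rewrite RintegralZl//; last first.
  apply: integrable_continuous_circle => t.
  by apply: cvgD; exact: continuous_sum_cosfreq.
rewrite RintegralD//; try exact: int_sum.
(* The frequencies [k i + k j] give a nonnegative total, which is dropped; among the differences
   only the terms j = i are kept. *)
rewrite !Rintegral_sum_cosfreq ler_pM2l// ler_wpDl ?sumr_ge0//.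
rewrite -(pair_big P P (fun i j => (k i - k j == 0)%:R))/=.
rewrite -sum1_card natr_sum; apply: ler_sum => i Pi.
by rewrite (bigD1 i)//= subrr eqxx lerDl sumr_ge0.
Qed.

End trigonometric_integrals.

(** * Squared modulus of the polynomials on the circle *)

Lemma expi_exp (R : realType) (x : R) n : expi x ^+ n = expi (x * n%:R).
Proof.
elim: n => [|n IHn]; first by rewrite expr0 mulr0 /expi cos0 sin0.
rewrite exprS IHn -natr1 mulrDr mulr1 addrC /expi cosD sinD.
by apply/eqP; rewrite eq_complex /= eqxx andTb addrC mulrC.
Qed.

(** The squares of the real and imaginary parts are double sums, combined termwise by cos a cos b +
    sin a sin b = cos(a - b). *)
Lemma normc_rank_one_poly (R : realType) (T : rank_one_param) (k : nat) (t : R)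
    (e := fun j => (j * height T k + spacer_sum T k j)%N) :
  ComplexField.Normc.normc (rank_one_poly R T k).[expi (2 * pi * t)] ^+ 2 =
  (cutting T k)%:R^-1 *
  \sum_(p : 'I_(cutting T k) * 'I_(cutting T k))
    cosfreq R ((e p.1)%:Z - (e p.2)%:Z) t.
Proof.
rewrite /rank_one_poly; set m := cutting T k.
rewrite hornerZ horner_sum ComplexField.Normc.normcM exprMn big_mkord.
congr (_ * _).
  rewrite /= expr0n addr0 sqr_sqrtr ?sqr_ge0// exprVn sqr_sqrtr//.
pose x := 2 * pi * t.
have -> : \sum_(j < m) ('X^(e j)).[expi x] =
    ((\sum_(j < m) cos (x * (e j)%:R)) +i* (\sum_(j < m) sin (x * (e j)%:R)))%C.
  elim/big_rec3 : _ => // j s c z _ ->.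
  by rewrite hornerXn expi_exp /expi; apply/eqP; rewrite eq_complex /= !eqxx.
rewrite /= sqr_sqrtr ?addr_ge0 ?sqr_ge0// !expr2 !big_distrlr/=
  !pair_big/= -big_split/=.
apply: eq_bigr => -[i j] _ /=.
rewrite -cosB /cosfreq; congr cos; rewrite /x rmorphB/= -!pmulrn; ring.
Qed.

Lemma ltn_rank_one_exponent T k i j : (i < j)%N ->
  (i * height T k + spacer_sum T k i < j * height T k + spacer_sum T k j)%N.
Proof.
move=> ij; have h0 : (0 < height T k)%N.
  elim: k => //= k IHk; rewrite ltn_addr// muln_gt0 IHk andbT.
  exact: leq_trans (cutting_ge2 T k).
rewrite -addSn leq_add ?ltn_pmul2r//.
by rewrite /spacer_sum [leqRHS](big_cat_nat (n := i.+1))/= ?leq_addr// ltnW.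
Qed.

(** Ensures that off-diagonal pairs have nonzero frequency, hence mean 0. *)
Lemma rank_one_exponent_inj T k :
  injective (fun j => (j * height T k + spacer_sum T k j)%N).
Proof.
move=> i j eij; apply/eqP.
have [] := ltngtP i j => // /(ltn_rank_one_exponent T k);
  by rewrite eij ltnn.
Qed.

(** * Bound on a single Mahler measure *)

(** One has log r <= r - 1 = (r^2 - 1)/2 - (r - 1)^2/2. Moreover (r^2 - 1)^2 = (r - 1)^2 (r + 1)^2,
    and (r + 1)^2 <= 2(r^2 + 1) <= 2(m + 1). *)
Lemma ln_le_half_square (R : realType) (r m : R) : 0 < r -> r ^+ 2 <= m ->
  ln r <= 2^-1 * (r ^+ 2 - 1) - (4 * (m + 1))^-1 * (r ^+ 2 - 1) ^+ 2.
Proof.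
move=> r0 rm; have m0 : 0 < m by apply: lt_le_trans rm; rewrite exprn_gt0.
apply: (@le_trans _ _ (r - 1)).
  by rewrite -{1}(subrKC 1 r) le_ln1Dx// ltrBrDl subrr.
have : (4 * (m + 1))^-1 * (r ^+ 2 - 1) ^+ 2 <= 2^-1 * (r - 1) ^+ 2.
  rewrite mulrC ler_pdivrMr; last lra.
  have -> : (r ^+ 2 - 1) ^+ 2 = (r - 1) ^+ 2 * (r + 1) ^+ 2 by ring.
  have -> : 2^-1 * (r - 1) ^+ 2 * (4 * (m + 1)) = (r - 1) ^+ 2 * (2 * (m + 1)).
    by field.
  apply: ler_wpM2l; first exact: sqr_ge0.
  by have := sqr_ge0 (r - 1); lra.
lra.
Qed.

Lemma mahler_rank_one_le (R : realType) (T : rank_one_param) (k : nat) :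
  (mahler_measure (rank_one_poly R T k) <=
    (expR (- (24 * (cutting T k)%:R)^-1))%:E)%E.
Proof.
set m := cutting T k; have m2 : 2 <= m%:R :> R by rewrite ler_nat cutting_ge2.
have m0 : m%:R != 0 :> R by rewrite gt_eqF//; lra.
pose e j := (j * height T k + spacer_sum T k j)%N.
pose k_ (p : 'I_m * 'I_m) : int := (e p.1)%:Z - (e p.2)%:Z.
pose D := [pred p : 'I_m * 'I_m | p.1 != p.2].
(* This [f] is not normalized: |P|^2 = 1 + f/m, the diagonal pairs accounting for the 1. *)
pose f (t : R) := \sum_(p | D p) cosfreq R (k_ p) t.
pose r (t : R) :=
  ComplexField.Normc.normc (rank_one_poly R T k).[expi (2 * pi * t)].
have cardDC : #|predC D| = m.
  rewrite -sum1_card (eq_bigl (fun p => p.1 == p.2)) => [|p]; last first.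
    by rewrite !inE negbK.
  rewrite -(pair_big_dep xpredT (fun i j => i == j) (fun _ _ => 1%N))/=.
  rewrite -[RHS](card_ord m) -sum1_card; apply: eq_bigr => i _.
  by rewrite (big_pred1 i)// => j; rewrite eq_sym.
have cardD : #|D|%:R = m%:R * (m%:R - 1) :> R.
  have : (#|D| + #|predC D| = m * m)%N by rewrite cardC card_prod card_ord.
  by rewrite cardDC => /(congr1 (fun n => n%:R : R)); rewrite natrD natrM; lra.
have r2E t : r t ^+ 2 - 1 = m%:R^-1 * f t.
  rewrite /r normc_rank_one_poly -/m (bigID D)/= -/(f t).
  rewrite [X in _ * (_ + X)](eq_bigr (fun=> 1)) => [|p]; last first.
    by rewrite negbK => /eqP->; rewrite subrr /cosfreq mulr0 mul0r cos0.
  by rewrite sumr_const -/(predC D) cardDC; field.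
have r2_le t : r t ^+ 2 <= m%:R.
  rewrite /r normc_rank_one_poly ler_pdivrMl; last lra.
  have -> : m%:R * m%:R = \sum_(p : 'I_m * 'I_m) 1 :> R.
    by rewrite sumr_const card_prod card_ord -natrM.
  by apply: ler_sum => p _; exact: cos_le1.
(* The bound of [ln_le_half_square] after substituting r^2 - 1 = f/m. *)
pose g t := (2 * m%:R)^-1 * f t - (4 * (m%:R + 1) * m%:R ^+ 2)^-1 * f t ^+ 2.
have lne_le t : (lne (r t)%:E <= (g t)%:E)%E.
  (* At a zero of the polynomial the logarithm is -oo and the bound is trivial. *)
  have [r0|r0] := leP (r t) 0; first by rewrite le0_lneNy ?leNye ?lee_fin.
  rewrite lne_EFin// lee_fin (le_trans (ln_le_half_square _ _ _ r0 (r2_le t)))//.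
  rewrite r2E le_eqVlt; apply/orP; left; apply/eqP; rewrite /g; field.
  by rewrite m0 gt_eqF//; lra.
have cf : continuous f by exact: continuous_sum_cosfreq.
have cf2 : continuous (fun t => f t ^+ 2).
  by move=> t; under eq_fun do rewrite expr2; apply: cvgM; exact: cf.
have k_neq0 p : D p -> k_ p != 0.
  rewrite subr_eq0 eqz_nat; apply: contra => /eqP.
  by move=> /rank_one_exponent_inj/val_inj->.
have int_g : \int[@lebesgue_measure R]_(t in `[0, 1]) g t <= - (24 * m%:R)^-1.
  rewrite RintegralB//; last 2 first.
  - apply: integrable_continuous_circle => t.
    by apply: cvgM; [exact: cvg_cst|exact: cf].
  - apply: integrable_continuous_circle => t.
    by apply: cvgM; [exact: cvg_cst|exact: cf2].
  rewrite !RintegralZl//; [|exact: integrable_continuous_circle..].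
  rewrite Rintegral_sum_cosfreq big1 => [|p /k_neq0/negPf->//].
  rewrite mulr0 sub0r lerN2.
  have := Rintegral_sqr_sum_cosfreq_ge R _ D k_; rewrite cardD.
  set J := (X in _ <= X) => J_ge.
  apply: le_trans (ler_wpM2l _ J_ge); last first.
    by rewrite invr_ge0 !mulr_ge0 ?sqr_ge0//; lra.
  (* The constant 24 is chosen so that the remaining factor 3(m - 1)/(m + 1) is at least 1, which
     amounts to m >= 2. *)
  have -> : (4 * (m%:R + 1) * m%:R ^+ 2)^-1 * (2^-1 * (m%:R * (m%:R - 1))) =
     (24 * m%:R)^-1 * (3 * (m%:R - 1) / (m%:R + 1)) :> R.
    by field; rewrite m0 gt_eqF//; lra.
  rewrite ler_peMr ?invr_ge0 ?mulr_ge0// ler_pdivlMr; lra.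
rewrite /mahler_measure -[(expR _)%:E]/(expeR (_)%:E) lee_expeR.
apply: (@le_trans _ _ (\int[@lebesgue_measure R]_(t in `[0%R, 1%R]) (g t)%:E)%E).
  by apply: le_integral_nonmeasurable => t _; exact: lne_le.
rewrite -[leLHS]fineK ?lee_fin//.
apply: integrable_fin_num => //; apply: integrable_continuous_circle => t.
by apply: cvgB; apply: cvgM; [exact: cvg_cst|exact: cf|exact: cvg_cst|exact: cf2].
Qed.

(** * Divergence of the sum of 1/m_j and conclusion *)

(** For j > j0 one has j >= 1, so j^beta <= j; the finitely many earlier values are absorbed by
    their sum [S]. The factor [j.+1] is positive at j = 0 and matches the harmonic series. *)
Lemma cutting_linear_bound (R : realType) (T : rank_one_param)
    (beta C : R) (j0 : nat) :
  beta <= 1 -> 0 < C ->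
  (forall j : nat, (j0 <= j)%N -> (cutting T j)%:R / (j%:R `^ beta) <= C) ->
  exists2 K : R, 0 < K & forall j, (cutting T j)%:R <= K * j.+1%:R.
Proof.
move=> beta1 C0 mC.
pose S : R := \sum_(i < j0.+1) (cutting T i)%:R.
have S0 : 0 <= S by rewrite sumr_ge0.
exists (C + S) => [|j]; first exact: ltr_wpDr.
have [jj0|j0j] := leqP j j0.
  have : (cutting T j)%:R <= S.
    by rewrite /S (bigD1 (Ordinal (jj0 : (j < j0.+1)%N)))//= lerDl sumr_ge0.
  move=> /le_trans; apply; rewrite -[leLHS]mulr1 ler_pM ?ler1n//.
  by rewrite lerDr ltW.
have j1 : 1 <= j%:R :> R by rewrite ler1n; exact: leq_ltn_trans j0j.
have /(_ (ltnW j0j)) := mC j.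
rewrite ler_pdivrMr ?powR_gt0//; last exact: lt_le_trans j1.
move=> /le_trans; apply; apply: ler_pM; rewrite ?powR_ge0 ?lerDl// ?(ltW C0)//.
apply: (@le_trans _ _ (j%:R `^ 1)); first by rewrite ler_powR.
by rewrite powRr1// ler_nat.
Qed.

(** Partial sums of a divergent nonnegative series tend to +oo. *)
Lemma cvg_expRN_series (R : realType) (u : R ^nat) : (forall n, 0 <= u n) ->
  ~ cvgn (series u) -> expR (- series u n) @[n --> \oo] --> 0.
Proof.
move=> u0 dvgu.
apply: (@cvg_comp _ _ _ (series u) (fun x => expR (- x)) _ (pinfty_nbhs R)).
  by apply: nondecreasing_dvgn_lt => //; exact: nondecreasing_series.
exact: cvgr_expR.
Qed.

Theorem theorem3p4 (R : realType) (T : rank_one_param) (beta : R)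
    (hbeta : beta <= 1)
    (hcut : exists (c C : R) (j0 : nat), 0 < c /\ 0 < C /\
       forall j : nat, (j0 <= j)%N ->
         c <= (cutting T j)%:R / (j%:R `^ beta) <= C) :
  (\prod_(0 <= j < n) mahler_measure (rank_one_poly R T j))%E
    @[n --> \oo] --> (0%R%:E : \bar R).
Proof.
have [c [C [j0 [_ [C0 mC]]]]] := hcut.
have [|K K0 mK] := @cutting_linear_bound R T beta C j0 hbeta C0.
  by move=> j /mC /andP[].
pose u j : R := (24 * (cutting T j)%:R)^-1.
have u0 j : 0 <= u j by rewrite invr_ge0 mulr_ge0.
have mahler_ge0 j : (0 <= mahler_measure (rank_one_poly R T j))%E.
  exact: expeR_ge0.
have dvgu : ~ cvgn (series u).
  move=> cvgu; apply: (@dvg_harmonic R).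
  (* Comparison: 1/(n + 1) <= K/m_n = 24 K u_n, so convergence of the series of [u] would make the
     harmonic series converge. *)
  apply: (@series_le_cvg _ _ ((24 * K) *: u)) => [n|n|n|].
  - exact: harmonic_ge0.
  - by rewrite mulr_ge0// mulr_ge0// ltW.
  - have m0 : 0 < (cutting T n)%:R :> R.
      by rewrite ltr0n (leq_trans _ (cutting_ge2 T n)).
    have -> : ((24 * K) *: u) n = K / (cutting T n)%:R.
      rewrite -[LHS]/(24 * K * (24 * (cutting T n)%:R)^-1).
      by field; rewrite gt_eqF.
    by rewrite ler_pdivlMr// mulrC ler_pdivrMr.
  - by rewrite seriesZ; exact: is_cvgZr.
(* The product of the individual bounds is exp of minus the partial sum of [u], which squeezes the
   partial products to 0. *)
apply: (@squeeze_cvge _ _ _ _ (cst 0%E) _ (fun n => (expR (- series u n))%:E)).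
- apply: nearW => n; rewrite prode_ge0//=.
  elim: n => [|n IHn].
    by rewrite big_nil /series/= big_nil oppr0 expR0.
  rewrite big_nat_recr//= seriesSr opprD expRD EFinM.
  by apply: lee_pmul => //; [exact: prode_ge0|exact: mahler_rank_one_le].
- exact: cvg_cst.
- apply: cvg_EFin; first exact: nearW.
  exact: cvg_expRN_series.
Qed.
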